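(* Suppose $k\ge1$ and $l\ge1$. Within ${\mathsf{SF}}$, the type $\rho_{k,l+1}$ is not a pseudo-retract of any finite product of types of sublevel $(k,l)$ or lower.
   Context: Types: $\sigma::=\mathbb{N}\mid\sigma\rightarrow\sigma$; $\sigma_0,\ldots,\sigma_{r-1}\rightarrow\mathbb{N}$ abbreviates $\sigma_0\rightarrow\cdots\rightarrow\sigma_{r-1}\rightarrow\mathbb{N}$. Level ${\mathrm{lv}}(\mathbb{N})=0$, ${\mathrm{lv}}(\sigma\rightarrow\tau)=\max({\mathrm{lv}}\,\sigma+1,{\mathrm{lv}}\,\tau)$. Width: $w(\mathbb{N})=0$, $w(\sigma_0,\ldots,\sigma_{r-1}\rightarrow\mathbb{N})=\max(r,w(\sigma_0),\ldots,w(\sigma_{r-1}))$. For $k,l\ge1$, $\sigma$ has sublevel $(k,l)$ if ${\mathrm{lv}}(\sigma)=k$ and $w(\sigma)=l$; $\mathbb{N}$ has sublevel $0$; sublevels are ordered with $0$ lowest and $(k,l)<(k',l')$ iff $k<k'$, or $k=k'$ and $l<l'$. $\rho_{0,l}=\mathbb{N}$, $\rho_{k+1,l}=\rho_{k,l},\ldots,\rho_{k,l}\rightarrow\mathbb{N}$ ($l$ arguments). ${\mathsf{SF}}(\sigma)$ is the set of closed ${\mathrm{PCF}}^\Omega$ terms of type $\sigma$ modulo observational equivalence (${\mathrm{PCF}}^\Omega$: simply typed $\lambda$-calculus over $\mathbb{N}$ with $\underline n,\mathit{suc},\mathit{pre},\mathit{ifzero}$, all $Y_\sigma$, and oracle constants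 $C_f$ for partial $f:\mathbb{N}\rightharpoonup\mathbb{N}$, with its call-by-name operational semantics; $M\simeq M'$ iff every closed context of type $\mathbb{N}$ yields the same numeral, if any, on both); it is an extensional type structure with ${\mathsf{SF}}(\mathbb{N})\cong\mathbb{N}_\bot$. The order $\preceq$ on ${\mathsf{SF}}(\sigma)$: $x\preceq x'$ iff $h\cdot x\sqsubseteq h\cdot x'$ for all $h\in{\mathsf{SF}}(\sigma\rightarrow\mathbb{N})$ (flat order on $\mathbb{N}_\bot$); at function types it is the pointwise order. $\rho$ is a pseudo-retract of the product $\prod_{i<m}\sigma_i$ if there exist $t_i\in{\mathsf{SF}}(\rho\rightarrow\sigma_i)$ ($i<m$) and $r\in{\mathsf{SF}}(\sigma_0\rightarrow\cdots\rightarrow\sigma_{m-1}\rightarrow\rho)$ with $r\cdot(t_0\cdot f)\cdots(t_{m-1}\cdot f)\succeq f$ for all $f\in{\mathsf{SF}}(\rho)$. *)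

(* Defs.v *)
(* The term model SF of PCF^Omega (Longley's sequentially
   realizable / sequential functionals), built syntactically. *)
From Stdlib Require Import List Arith.
Import ListNotations.

Inductive ty : Type :=
| N : ty
| Arr : ty -> ty -> ty.

Fixpoint lv (t : ty) : nat :=
  match t with
  | N => 0
  | Arr s u => Nat.max (S (lv s)) (lv u)
  end.

Fixpoint arity (t : ty) : nat :=
  match t with
  | N => 0
  | Arr _ u => S (arity u)
  end.

Fixpoint wargs (t : ty) : nat :=
  match t with
  | N => 0
  | Arr s u => Nat.max (Nat.max (arity s) (wargs s)) (wargs u)
  end.

(** width: w(N) = 0, w(s_0,..,s_{r-1} -> N) = max(r, w s_0, ..., w s_{r-1}) *)
Definition width (t : ty) : nat := Nat.max (arity t) (wargs t).

(** sublevels: N has sublevel 0 (the lowest); otherwise (lv t, width t),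
    ordered lexicographically.  [sublevel_le t k l] : t has sublevel
    (k,l) or lower (for k, l >= 1). *)
Definition sublevel (t : ty) : option (nat * nat) :=
  match t with
  | N => None
  | _ => Some (lv t, width t)
  end.

Definition sublevel_le (t : ty) (k l : nat) : Prop :=
  match sublevel t with
  | None => True
  | Some (k', l') => k' < k \/ (k' = k /\ l' <= l)
  end.

Fixpoint rho (k l : nat) : ty :=
  match k with
  | 0 => N
  | S k' => Nat.iter l (Arr (rho k' l)) N
  end.

Inductive tm : Type :=
| Var : nat -> tm
| Lam : ty -> tm -> tm
| App : tm -> tm -> tm
| Num : nat -> tm
| Suc : tm
| Pre : tm
| Ifz : tm
| Yc : ty -> tm
| Orc : (nat -> option nat) -> tm.

Inductive has_type : list ty -> tm -> ty -> Prop :=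
| T_Var : forall G i s, nth_error G i = Some s -> has_type G (Var i) s
| T_Lam : forall G s t b, has_type (s :: G) b t -> has_type G (Lam s b) (Arr s t)
| T_App : forall G s t a b, has_type G a (Arr s t) -> has_type G b s ->
    has_type G (App a b) t
| T_Num : forall G n, has_type G (Num n) N
| T_Suc : forall G, has_type G Suc (Arr N N)
| T_Pre : forall G, has_type G Pre (Arr N N)
| T_Ifz : forall G, has_type G Ifz (Arr N (Arr N (Arr N N)))
| T_Y : forall G s, has_type G (Yc s) (Arr (Arr s s) s)
| T_Orc : forall G f, has_type G (Orc f) (Arr N N).

Definition closed_of (M : tm) (s : ty) : Prop := has_type [] M s.

Definition upren (r : nat -> nat) : nat -> nat :=
  fun i => match i with 0 => 0 | S j => S (r j) end.

Fixpoint ren (r : nat -> nat) (t : tm) : tm :=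
  match t with
  | Var i => Var (r i)
  | Lam s b => Lam s (ren (upren r) b)
  | App a b => App (ren r a) (ren r b)
  | c => c
  end.

Definition up (sg : nat -> tm) : nat -> tm :=
  fun i => match i with 0 => Var 0 | S j => ren S (sg j) end.

Fixpoint subst (sg : nat -> tm) (t : tm) : tm :=
  match t with
  | Var i => sg i
  | Lam s b => Lam s (subst (up sg) b)
  | App a b => App (subst sg a) (subst sg b)
  | c => c
  end.

Definition subst0 (u : tm) (t : tm) : tm :=
  subst (fun i => match i with 0 => u | S j => Var j end) t.

Inductive step : tm -> tm -> Prop :=
| S_Beta : forall s b u, step (App (Lam s b) u) (subst0 u b)
| S_Y : forall s M, step (App (Yc s) M) (App M (App (Yc s) M))
| S_Suc : forall n, step (App Suc (Num n)) (Num (S n))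
| S_Pre : forall n, step (App Pre (Num n)) (Num (Nat.pred n))
| S_Ifz0 : forall M P, step (App (App (App Ifz (Num 0)) M) P) M
| S_IfzS : forall n M P, step (App (App (App Ifz (Num (S n))) M) P) P
| S_Orc : forall f n m, f n = Some m -> step (App (Orc f) (Num n)) (Num m)
| S_AppL : forall a a' b, step a a' -> step (App a b) (App a' b)
| S_SucArg : forall a a', step a a' -> step (App Suc a) (App Suc a')
| S_PreArg : forall a a', step a a' -> step (App Pre a) (App Pre a')
| S_IfzArg : forall a a', step a a' -> step (App Ifz a) (App Ifz a')
| S_OrcArg : forall f a a', step a a' -> step (App (Orc f) a) (App (Orc f) a').

Inductive steps : tm -> tm -> Prop :=
| steps_refl : forall M, steps M M
| steps_step : forall M M' M'', step M M' -> steps M' M'' -> steps M M''.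

Definition evalN (M : tm) (n : nat) : Prop := steps M (Num n).

(** * Observational equivalence (defining SF(s) as a quotient).
    A closed context C[-] of type N with hole of type s is represented
    by a term C with one free variable (index 0) of type s; C[M] is
    substitution of the closed term M for that variable. *)
Definition obs_equiv (s : ty) (M M' : tm) : Prop :=
  forall C, has_type [s] C N ->
    forall n, evalN (subst0 M C) n <-> evalN (subst0 M' C) n.

(** * The order on SF(s): x ⪯ x' iff h·x ⊑ h·x' for all h in SF(s -> N)
    (flat order on N_bot).  Stated on representatives (closed terms);
    it is invariant under obs_equiv. *)
Definition sf_le (s : ty) (x x' : tm) : Prop :=
  forall h, closed_of h (Arr s N) ->
    forall n, evalN (App h x) n -> evalN (App h x') n.

Definition apps (r : tm) (args : list tm) : tm := fold_left App args r.

Definition arrows (ss : list ty) (t : ty) : ty := fold_right Arr t ss.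

Definition pseudo_retract (rh : ty) (ss : list ty) : Prop :=
  exists (ts : list tm) (r : tm),
    Forall2 (fun t s => closed_of t (Arr rh s)) ts ss /\
    closed_of r (arrows ss rh) /\
    forall f, closed_of f rh ->
      sf_le rh f (apps r (map (fun t => App t f) ts)).

(* Main.v *)
(* Let [r], [t_j] witness a pseudo-retraction at [k + 1], and reduce the open term
   [r (t_0 z) ... (t_m z) x_0 ... x_l].  Taking [z] constant and all [x_i] divergent shows
   that it reaches a call [z p_0 ... p_l] at its head; testing with [z] that returns only if
   its [i]-th argument passes a given observation shows that [p_i], with [z] replaced by a
   constant function, dominates [x_i].  In the dialogue between [r] and the [t_j] the
   arguments of [z] are built on the side of the [t_j], to which information about the [x_i]
   crosses only through arguments of the types [sigma_j], hence of sublevel at most [(k, l)].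
   So for [k >= 1] the type [rho_{k,l+1}] is a pseudo-retract of finitely many types of
   sublevel at most [(k, l)], and induction applies.  For [k = 0] at most [l] ground values
   cross, whereas [x_0, ..., x_l] can become defined one at a time in [l + 1] steps. *)
Require Import Defs.
From Stdlib Require Import List Arith Lia Classical.
Import ListNotations.

(** * Renaming and substitution of de Bruijn terms *)

Lemma ren_ext M : forall r r', (forall i, r i = r' i) -> ren r M = ren r' M.
Proof.
  induction M; intros r r' H; simpl; auto; f_equal; auto.
  apply IHM. intros [|i]; simpl; auto.
Qed.

Lemma subst_ext M : forall s s', (forall i, s i = s' i) -> subst s M = subst s' M.
Proof.
  induction M; intros r r' H; simpl; auto; f_equal; auto.
  apply IHM. intros [|i]; simpl; auto. now rewrite H.
Qed.

Lemma ren_id M : forall r, (forall i, r i = i) -> ren r M = M.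
Proof.
  induction M; intros r H; simpl; auto; f_equal; auto.
  apply IHM. intros [|i]; simpl; auto.
Qed.

Lemma subst_id M : forall s, (forall i, s i = Var i) -> subst s M = M.
Proof.
  induction M; intros r H; simpl; auto; f_equal; auto.
  apply IHM. intros [|i]; simpl; auto. now rewrite H.
Qed.

Lemma ren_ren M : forall r r', ren r (ren r' M) = ren (fun i => r (r' i)) M.
Proof.
  induction M; intros r r'; simpl; auto; f_equal; auto.
  rewrite IHM. apply ren_ext. intros [|i]; simpl; auto.
Qed.

Lemma subst_ren M : forall s r, subst s (ren r M) = subst (fun i => s (r i)) M.
Proof.
  induction M; intros r r'; simpl; auto; f_equal; auto.
  rewrite IHM. apply subst_ext. intros [|i]; simpl; auto.
Qed.

Lemma ren_subst M : forall r s, ren r (subst s M) = subst (fun i => ren r (s i)) M.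
Proof.
  induction M; intros r r'; simpl; auto; f_equal; auto.
  rewrite IHM. apply subst_ext. intros [|i]; simpl; auto.
  rewrite !ren_ren. apply ren_ext. auto.
Qed.

Lemma subst_subst M : forall s s', subst s (subst s' M) = subst (fun i => subst s (s' i)) M.
Proof.
  induction M; intros r r'; simpl; auto; f_equal; auto.
  rewrite IHM. apply subst_ext. intros [|i]; simpl; auto.
  rewrite subst_ren, ren_subst. apply subst_ext. auto.
Qed.

Lemma subst0_subst s u b : subst0 (subst s u) (subst (up s) b) = subst s (subst0 u b).
Proof.
  unfold subst0. rewrite !subst_subst. apply subst_ext.
  intros [|i]; simpl; auto. rewrite subst_ren. now apply subst_id.
Qed.

Lemma step_subst s M M' : step M M' -> step (subst s M) (subst s M').
Proof.
  induction 1; simpl; try (constructor; auto; fail).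
  rewrite <- subst0_subst. constructor.
Qed.

(** * Typing under substitution, subject reduction, determinism *)

Lemma has_type_ren G M t : has_type G M t -> forall G' r,
  (forall i s, nth_error G i = Some s -> nth_error G' (r i) = Some s) ->
  has_type G' (ren r M) t.
Proof.
  induction 1; intros G' r Hr; simpl; try (econstructor; eauto; fail).
  constructor. apply IHhas_type. intros [|i] s'; simpl; auto.
Qed.

Lemma has_type_subst G M t : has_type G M t -> forall G' sg,
  (forall i s, nth_error G i = Some s -> has_type G' (sg i) s) ->
  has_type G' (subst sg M) t.
Proof.
  induction 1; intros G' r Hr; simpl; try (econstructor; eauto; fail).
  - auto.
  - constructor. apply IHhas_type. intros [|i] s'; simpl; intros E.
    + constructor; auto.
    + eapply has_type_ren; eauto.
Qed.

Lemma has_type_app_ctx G G' M t : has_type G M t -> has_type (G ++ G') M t.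
Proof.
  intros H. rewrite <- (ren_id M (fun i => i)) by auto.
  eapply has_type_ren; eauto. intros i s E.
  rewrite nth_error_app1; auto. apply nth_error_Some. congruence.
Qed.

Lemma closed_weaken G M t : closed_of M t -> has_type G M t.
Proof. apply (has_type_app_ctx []). Qed.

Lemma subst_agree G M t : has_type G M t -> forall s s',
  (forall i, i < length G -> s i = s' i) -> subst s M = subst s' M.
Proof.
  induction 1; intros r r' Hr; simpl; auto.
  - apply Hr. apply nth_error_Some. congruence.
  - f_equal. apply IHhas_type. intros [|i]; simpl; auto. intros. rewrite Hr; auto; lia.
  - f_equal; auto.
Qed.

Lemma subst_closed M t s : closed_of M t -> subst s M = M.
Proof.
  intros H. rewrite (subst_agree _ _ _ H s Var) by (simpl; lia). now apply subst_id.
Qed.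

Lemma has_type_unique G M t : has_type G M t -> forall t', has_type G M t' -> t = t'.
Proof.
  induction 1; intros t' H'; inversion H'; subst; try congruence.
  - f_equal; auto.
  - apply IHhas_type1 in H4. congruence.
Qed.

Lemma has_type_subst0 G s u b t :
  has_type (s :: G) b t -> has_type G u s -> has_type G (subst0 u b) t.
Proof.
  intros Hb Hu. eapply has_type_subst; eauto. intros [|i] s'; simpl; intros E.
  - congruence.
  - now constructor.
Qed.

Lemma preservation G M M' t : has_type G M t -> step M M' -> has_type G M' t.
Proof.
  intros HT St. revert t HT. induction St; intros t HT; inversion HT; subst; clear HT;
    repeat match goal with
    | X : has_type _ (App _ _) _ |- _ => inversion X; subst; clear X
    | X : has_type _ (Lam _ _) _ |- _ => inversion X; subst; clear X
    | X : has_type _ (Yc _) _ |- _ => inversion X; subst; clear X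
    | X : has_type _ Suc _ |- _ => inversion X; subst; clear X
    | X : has_type _ Pre _ |- _ => inversion X; subst; clear X
    | X : has_type _ Ifz _ |- _ => inversion X; subst; clear X
    | X : has_type _ (Orc _) _ |- _ => inversion X; subst; clear X
    end; try (repeat econstructor; eauto; fail); auto.
  eapply has_type_subst0; eauto.
Qed.

Lemma step_det M M1 : step M M1 -> forall M2, step M M2 -> M1 = M2.
Proof.
  induction 1; intros M2 H2; inversion H2; subst; auto;
    repeat match goal with
    | X : step (App _ _) _ |- _ => inversion X; subst; clear X
    | X : step (Lam _ _) _ |- _ => inversion X
    | X : step (Num _) _ |- _ => inversion X
    | X : step Suc _ |- _ => inversion X
    | X : step Pre _ |- _ => inversion X
    | X : step Ifz _ |- _ => inversion X
    | X : step (Orc _) _ |- _ => inversion X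
    | X : step (Yc _) _ |- _ => inversion X
    end; try congruence; f_equal; auto.
Qed.

Lemma steps_trans M1 M2 M3 : steps M1 M2 -> steps M2 M3 -> steps M1 M3.
Proof. induction 1; eauto using steps. Qed.

Lemma steps_subst s M M' : steps M M' -> steps (subst s M) (subst s M').
Proof. induction 1; eauto using steps, step_subst. Qed.

Lemma steps_preservation G M M' t : has_type G M t -> steps M M' -> has_type G M' t.
Proof. intros H St. induction St; eauto using preservation. Qed.

(** Reduction is deterministic and numerals are normal, so the steps already made lie on the path to
    the numeral. *)
Lemma evalN_steps M M' n : steps M M' -> evalN M n -> evalN M' n.
Proof.
  unfold evalN. induction 1; auto. intros E. apply IHsteps.
  inversion E; subst.
  - inversion H.
  - now rewrite (step_det _ _ H _ H1).
Qed.

Lemma evalN_det M m n : evalN M m -> evalN M n -> m = n.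
Proof.
  intros H1 H2. apply (evalN_steps _ _ _ H1) in H2.
  inversion H2; subst; auto. inversion H.
Qed.

(** Evaluation with its number of steps, the measure for inductions that follow the reduction of an
    open term under a closing substitution. *)
Inductive evaln : nat -> tm -> nat -> Prop :=
| evaln_num n : evaln 0 (Num n) n
| evaln_step j M M' n : step M M' -> evaln j M' n -> evaln (S j) M n.

Lemma evalN_evaln M n : evalN M n -> exists j, evaln j M n.
Proof.
  unfold evalN. remember (Num n) as V. induction 1; subst.
  - exists 0. constructor.
  - destruct IHsteps as [j Hj]; auto. exists (S j). econstructor; eauto.
Qed.

Lemma evaln_evalN j M n : evaln j M n -> evalN M n.
Proof. unfold evalN. induction 1; eauto using steps. Qed.

Lemma evaln_inv_step j M M' n : evaln j M n -> step M M' ->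
  exists j', j = S j' /\ evaln j' M' n.
Proof.
  intros H St. inversion H; subst.
  - inversion St.
  - rewrite (step_det _ _ St _ H0). eauto.
Qed.

(** * Evaluation contexts and progress *)

Inductive frame : Type :=
| FApp : tm -> frame
| FSuc : frame
| FPre : frame
| FIfz : frame
| FOrc : (nat -> option nat) -> frame.

Definition plug (F : frame) (M : tm) : tm :=
  match F with
  | FApp b => App M b
  | FSuc => App Suc M
  | FPre => App Pre M
  | FIfz => App Ifz M
  | FOrc f => App (Orc f) M
  end.

Definition fill (E : list frame) (M : tm) : tm := fold_right plug M E.

Definition fsubst (s : nat -> tm) (F : frame) : frame :=
  match F with FApp b => FApp (subst s b) | F => F end.

Lemma subst_fill s E M : subst s (fill E M) = fill (map (fsubst s) E) (subst s M).
Proof. induction E as [|[]]; simpl; auto; now rewrite IHE. Qed.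

Lemma step_fill E M M' : step M M' -> step (fill E M) (fill E M').
Proof. intros H. induction E as [|[]]; simpl; auto using step. Qed.

Lemma steps_fill E M M' : steps M M' -> steps (fill E M) (fill E M').
Proof. induction 1; eauto using steps, step_fill. Qed.

Lemma fill_app E E' M : fill (E ++ E') M = fill E (fill E' M).
Proof. apply fold_right_app. Qed.

Lemma apps_fill M ps : apps M ps = fill (rev (map FApp ps)) M.
Proof.
  revert M. induction ps; intros M; simpl; auto.
  rewrite fill_app. simpl. now rewrite <- IHps.
Qed.

Lemma apps_snoc M ps p : apps M (ps ++ [p]) = App (apps M ps) p.
Proof. unfold apps. now rewrite fold_left_app. Qed.

Lemma subst_apps s M ps : subst s (apps M ps) = apps (subst s M) (map (subst s) ps).
Proof. revert M. induction ps; intros M; [reflexivity|]. apply (IHps (App M a)). Qed.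

Lemma steps_apps M M' ps : steps M M' -> steps (apps M ps) (apps M' ps).
Proof. rewrite !apps_fill. apply steps_fill. Qed.

Lemma fill_type G E M t : has_type G (fill E M) t -> exists s, has_type G M s /\
  forall M', has_type G M' s -> has_type G (fill E M') t.
Proof.
  revert t. induction E as [|[] E IH]; simpl; intros ty H; eauto;
    inversion H; subst;
    match goal with
    | X : has_type _ (fill _ _) _ |- _ =>
        destruct (IH _ X) as (s1 & H1 & H2); exists s1; split; auto;
        intros; econstructor; eauto
    end.
Qed.

Inductive value : tm -> Prop :=
| V_Num n : value (Num n)
| V_Lam s b : value (Lam s b)
| V_Suc : value Suc
| V_Pre : value Pre
| V_Ifz : value Ifz
| V_Ifz1 n : value (App Ifz (Num n))
| V_Ifz2 n M : value (App (App Ifz (Num n)) M)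
| V_Y s : value (Yc s)
| V_Orc f : value (Orc f).

(** Oracles are partial, so a closed ground term may be normal without being a numeral. The query
    without answer sits in evaluation position, which is why frames and substitutions preserve
    this. *)
Definition stuck (M : tm) : Prop :=
  exists E f n, f n = None /\ M = fill E (App (Orc f) (Num n)).

Lemma stuck_normal M : stuck M -> ~ value M /\ forall M', ~ step M M'.
Proof.
  intros (E & f & n & Hf & ->). induction E as [|F E [IHv IHs]]; simpl.
  - split; [intros H; inversion H|]. intros M' H. inversion H; subst; try congruence.
    + inversion H3.
    + inversion H3.
  - destruct F; simpl; (split; [intros H | intros M' H]); inversion H; subst;
      try (apply IHv; match goal with X : _ = fill _ _ |- _ => rewrite <- X end; constructor);
      try (eapply IHs; eauto; fail);
      match goal with X : step _ _ |- _ => inversion X end.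
Qed.

Lemma stuck_fill E M : stuck M -> stuck (fill E M).
Proof.
  intros (E' & f & n & Hf & ->). exists (E ++ E'), f, n. now rewrite fill_app.
Qed.

Lemma stuck_subst s M : stuck M -> stuck (subst s M).
Proof.
  intros (E & f & n & Hf & ->). exists (map (fsubst s) E), f, n.
  now rewrite subst_fill.
Qed.

Lemma stuck_evalN M n : stuck M -> ~ evalN M n.
Proof.
  intros Hs H. destruct (stuck_normal _ Hs) as [Hv Hn]. inversion H; subst.
  - apply Hv. constructor.
  - eapply Hn; eauto.
Qed.

(** Reduction waits for a variable at the head. The ground type of the application makes its list of
    arguments complete. *)
Definition blocked (G : list ty) (M : tm) : Prop :=
  exists E i ps, M = fill E (apps (Var i) ps) /\ has_type G (apps (Var i) ps) N.

Lemma blocked_fill G E M : blocked G M -> blocked G (fill E M).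
Proof.
  intros (E' & i & ps & -> & H). exists (E ++ E'), i, ps. now rewrite fill_app.
Qed.

Lemma value_N G M : value M -> has_type G M N -> exists n, M = Num n.
Proof.
  destruct 1; intros H; eauto; inversion H; subst;
    repeat match goal with X : has_type _ _ (Arr _ _) |- _ => inversion X; subst; clear X end.
Qed.

(** The last alternative admits a variable with an incomplete list of arguments. The induction on
    typing meets it in function position; at ground type it becomes [blocked]. *)
Definition progresses (G : list ty) (M : tm) : Prop :=
  value M \/ (exists M', step M M') \/ stuck M \/ blocked G M \/
  (exists i ps, M = apps (Var i) ps).

Lemma progress_plug G F M : has_type G M N -> progresses G M ->
  (exists n, M = Num n) \/ (exists M', step (plug F M) M') \/ stuck (plug F M) \/
  blocked G (plug F M).
Proof.
  intros Ha [V|[[M' S]|[S|[B|(i & ps & ->)]]]].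
  - left. eapply value_N; eauto.
  - right; left. eexists. apply (step_fill [F]). eauto.
  - right; right; left. now apply (stuck_fill [F]).
  - right; right; right. now apply (blocked_fill _ [F]).
  - right; right; right. exists [F], i, ps. auto.
Qed.

Lemma progress_gen G M t : has_type G M t -> progresses G M.
Proof.
  unfold progresses. induction 1; try (left; constructor; fail).
  - right; right; right; right. exists i, []. auto.
  - destruct IHhas_type1 as [V|[[M' S]|[S|[B|(i & ps & ->)]]]].
    + destruct V; try (inversion H; fail).
      * right; left; eexists; constructor.
      * inversion H; subst. destruct (progress_plug _ FSuc b H0 IHhas_type2) as [[n ->]|?]; [|tauto].
        right; left; eexists; constructor.
      * inversion H; subst. destruct (progress_plug _ FPre b H0 IHhas_type2) as [[n ->]|?]; [|tauto].
        right; left; eexists; constructor.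
      * inversion H; subst. destruct (progress_plug _ FIfz b H0 IHhas_type2) as [[n ->]|?]; [|tauto].
        left; constructor.
      * left; constructor.
      * right; left. destruct n; eexists; constructor.
      * right; left; eexists; constructor.
      * inversion H; subst.
        destruct (progress_plug _ (FOrc f) b H0 IHhas_type2) as [[n ->]|?]; [|tauto].
        destruct (f n) as [m|] eqn:Ef.
        -- right; left; exists (Num m). now constructor.
        -- right; right; left. exists [], f, n. auto.
    + right; left. eexists. constructor. eauto.
    + right; right; left. now apply (stuck_fill [FApp b]).
    + right; right; right; left. now apply (blocked_fill _ [FApp b]).
    + right; right; right; right. exists i, (ps ++ [b]). now rewrite apps_snoc.
Qed.

Lemma progress G M : has_type G M N ->
  (exists n, M = Num n) \/ (exists M', step M M') \/ stuck M \/ blocked G M.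
Proof.
  intros H. destruct (progress_gen _ _ _ H) as [V|[S|[S|[B|(i & ps & ->)]]]]; auto.
  - left. eapply value_N; eauto.
  - right; right; right. exists [], i, ps. auto.
Qed.

Lemma apps_type G M ps t : has_type G (apps M ps) t -> exists s, has_type G M s /\
  forall M', has_type G M' s -> has_type G (apps M' ps) t.
Proof.
  rewrite apps_fill. intros H. destruct (fill_type _ _ _ _ H) as (s & H1 & H2).
  exists s. split; auto. intros. rewrite apps_fill. auto.
Qed.

Lemma closed_not_blocked M : ~ blocked [] M.
Proof.
  intros (E & i & ps & _ & H). destruct (apps_type _ _ _ _ H) as (s & H1 & _).
  inversion H1; subst. destruct i; discriminate.
Qed.

(** The hole of a call-by-name evaluation context is the active position: nothing around a closed
    ground term can react before that term has become a numeral. *)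
Lemma evalN_fill E M n : closed_of M N -> evalN (fill E M) n ->
  exists m, evalN M m /\ evalN (fill E (Num m)) n.
Proof.
  intros HM Hev. destruct (evalN_evaln _ _ Hev) as [j Hj]. clear Hev.
  revert M HM Hj. induction j; intros M HM Hj;
    (destruct (progress _ _ HM) as [[m ->]|[[M' S]|[S|B]]];
      [ exists m; split; [constructor | eapply evaln_evalN; eauto]
      | destruct (evaln_inv_step _ _ _ _ Hj (step_fill E _ _ S)) as (j' & Ej & Hj')
      | exfalso; eapply stuck_evalN; [apply (stuck_fill E), S | eapply evaln_evalN; eauto]
      | exfalso; eapply closed_not_blocked; eauto ]).
  - discriminate.
  - injection Ej as <-. destruct (IHj M') as (m & H1 & H2); auto.
    { eapply preservation; eauto. }
    exists m. split; auto. econstructor; eauto.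
Qed.

Lemma evalN_expand E M m n : evalN M m -> evalN (fill E (Num m)) n -> evalN (fill E M) n.
Proof. intros H1 H2. eapply steps_trans; [apply steps_fill, H1 | exact H2]. Qed.

(** * The applicative order and the context lemma *)

Fixpoint occ (d : nat) (M : tm) : nat :=
  match M with
  | Var i => if d <=? i then 1 else 0
  | Lam _ b => occ (S d) b
  | App a b => occ d a + occ d b
  | _ => 0
  end.

Lemma occ_bounded G M t : has_type G M t -> forall d, length G <= d -> occ d M = 0.
Proof.
  induction 1; intros d Hd; simpl; auto.
  - assert (i < length G) by (apply nth_error_Some; congruence).
    destruct (Nat.leb_spec d i); lia.
  - apply IHhas_type. simpl; lia.
  - rewrite IHhas_type1, IHhas_type2; auto.
Qed.

Lemma occ_fill d E M M' : occ d M' < occ d M -> occ d (fill E M') < occ d (fill E M).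
Proof. intros H. induction E as [|[]]; simpl; auto; lia. Qed.

Lemma occ_apps d M M' ps : occ d M' < occ d M -> occ d (apps M' ps) < occ d (apps M ps).
Proof. rewrite !apps_fill. apply occ_fill. Qed.

(** Observation by application alone, as opposed to arbitrary contexts; the context lemma bridges
    the two. *)
Definition app_le (M M' : tm) : Prop :=
  forall ps n, closed_of (apps M ps) N -> evalN (apps M ps) n -> evalN (apps M' ps) n.

Lemma app_le_refl M : app_le M M.
Proof. intros ps n _ H. exact H. Qed.

Lemma app_le_steps M M' : steps M' M -> app_le M M'.
Proof.
  intros H ps n _ E. eapply steps_trans; [apply steps_apps, H | exact E].
Qed.

(* Milner's context lemma.  The variable at the head of a blocked term is first replaced
   by the closed term that the smaller substitution assigns to it: this leaves the
   evaluation unchanged but removes one free occurrence. *)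
Lemma context_lemma G sg sg' :
  (forall i s, nth_error G i = Some s ->
     closed_of (sg i) s /\ closed_of (sg' i) s /\ app_le (sg i) (sg' i)) ->
  forall M n, has_type G M N -> evalN (subst sg M) n -> evalN (subst sg' M) n.
Proof.
  intros Hsg M n HM Hev. destruct (evalN_evaln _ _ Hev) as [j Hj]. clear Hev.
  revert M HM Hj. induction j as [j IHj] using (well_founded_induction lt_wf).
  intros M. remember (occ 0 M) as c eqn:Ec. revert M Ec.
  induction c as [c IHc] using (well_founded_induction lt_wf). intros M -> HM Hj.
  destruct (progress _ _ HM) as [[m ->]|[[M' S]|[S|(E & i & ps & -> & Hps)]]].
  - exact (evaln_evalN _ _ _ Hj).
  - destruct (evaln_inv_step _ _ _ _ Hj (step_subst sg _ _ S)) as (j' & -> & Hj').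
    econstructor; [apply step_subst, S|].
    eapply (IHj j'); eauto using preservation.
  - exfalso. eapply stuck_evalN; [apply (stuck_subst sg), S | eapply evaln_evalN; eauto].
  - destruct (apps_type _ _ _ _ Hps) as (s & Hi & Happ).
    inversion Hi as [G0 i0 s0 Hn| | | | | | | |]; subst.
    destruct (Hsg _ _ Hn) as (Hc & Hc' & Hle).
    destruct (fill_type _ _ _ _ HM) as (s1 & Hs1 & Hfill).
    rewrite (has_type_unique _ _ _ Hs1 _ Hps) in Hfill.
    set (M2 := fill E (apps (sg i) ps)).
    assert (HM2 : has_type G (apps (sg i) ps) N) by (apply Happ, closed_weaken, Hc).
    assert (E2 : evalN (subst sg' M2) n).
    { apply (IHc (occ 0 M2)); auto.
      - apply occ_fill, occ_apps. rewrite (occ_bounded [] _ _ Hc) by (simpl; lia).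
        simpl. lia.
      - apply Hfill, HM2.
      - unfold M2. rewrite subst_fill, subst_apps in Hj |- *.
        now rewrite (subst_closed _ _ sg Hc). }
    unfold M2 in E2. rewrite subst_fill, subst_apps in E2 |- *. simpl.
    rewrite (subst_closed _ _ sg' Hc) in E2.
    (* At this point arguments and context carry [sg'] while the head is still [sg i]. The head call
       is isolated at ground type, where the applicative order exchanges it. *)
    assert (HT : closed_of (apps (sg i) (map (subst sg') ps)) N).
    { rewrite <- (subst_closed _ _ sg' Hc), <- subst_apps.
      eapply has_type_subst; eauto. intros i' s' H'. apply (Hsg _ _ H'). }
    destruct (evalN_fill _ _ _ HT E2) as (m & H1 & H2).
    eapply evalN_expand; eauto.
Qed.

(** * Environments and iterated abstraction *)

Definition env (e : list tm) : nat -> tm := fun i => nth i e (Var (i - length e)).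

(** The default value of [env] moves the variables beyond the environment down by its length, so a
    further beta step merely extends the environment. *)
Lemma env_subst0 e p b : subst0 p (subst (up (env e)) b) = subst (env (p :: e)) b.
Proof.
  unfold subst0. rewrite subst_subst. apply subst_ext. intros [|i]; simpl; auto.
  rewrite subst_ren. now apply subst_id.
Qed.

Lemma subst_env_nil M : subst (env []) M = M.
Proof. apply subst_id. intros i. unfold env. destruct i; simpl; auto. Qed.

Lemma subst0_env p b : subst0 p b = subst (env [p]) b.
Proof.
  apply subst_ext. intros [|[|i]]; reflexivity.
Qed.

Lemma env_nth e i p : nth_error e i = Some p -> env e i = p.
Proof. intros H. unfold env. now apply nth_error_nth. Qed.

Lemma Forall2_nth {X Y} (R : X -> Y -> Prop) xs ys i y :
  Forall2 R xs ys -> nth_error ys i = Some y -> exists x, nth_error xs i = Some x /\ R x y.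
Proof.
  intros H. revert i. induction H; intros [|i] E; simpl in *; try discriminate; eauto.
  injection E as <-. eauto.
Qed.

Lemma has_type_env G D e M t :
  Forall2 (has_type D) e G -> has_type G M t -> has_type D (subst (env e) M) t.
Proof.
  intros He HM. eapply has_type_subst; eauto. intros i s Hi.
  destruct (Forall2_nth _ _ _ _ _ He Hi) as (p & Hp & Ht). now rewrite (env_nth _ _ _ Hp).
Qed.

Lemma context_lemma_env G e e' M n :
  Forall2 closed_of e G -> Forall2 closed_of e' G -> Forall2 app_le e e' ->
  has_type G M N -> evalN (subst (env e) M) n -> evalN (subst (env e') M) n.
Proof.
  intros He He' Hle. apply context_lemma. intros i s Hi.
  destruct (Forall2_nth _ _ _ _ _ He' Hi) as (p' & Hp' & Ht').
  destruct (Forall2_nth _ _ _ _ _ He Hi) as (p & Hp & Ht).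
  destruct (Forall2_nth _ _ _ _ _ Hle Hp') as (p0 & Hp0 & Hl).
  rewrite (env_nth _ _ _ Hp), (env_nth _ _ _ Hp').
  assert (p0 = p) as -> by congruence. auto.
Qed.

Definition lams (ss : list ty) (B : tm) : tm := fold_right Lam B ss.

(** The last argument is bound innermost and receives index 0, hence the reversal. *)
Lemma steps_lams ss ps B : length ps = length ss -> forall e,
  steps (apps (subst (env e) (lams ss B)) ps) (subst (env (rev ps ++ e)) B).
Proof.
  revert ps. induction ss as [|s ss IH]; intros [|p ps] H e; try discriminate; simpl.
  - constructor.
  - eapply steps_trans.
    { apply steps_apps. econstructor; [constructor|]. rewrite env_subst0. constructor. }
    rewrite <- app_assoc. simpl. apply IH. simpl in H. lia.
Qed.

Lemma steps_lams_closed ss ps B : length ps = length ss ->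
  steps (apps (lams ss B) ps) (subst (env (rev ps)) B).
Proof.
  intros H. pose proof (steps_lams ss ps B H []) as E.
  now rewrite subst_env_nil, app_nil_r in E.
Qed.

Lemma has_type_lams ss G B t : has_type (rev ss ++ G) B t -> has_type G (lams ss B) (arrows ss t).
Proof.
  revert G. induction ss; intros G H; simpl in *; auto.
  constructor. apply IHss. now rewrite <- app_assoc in H.
Qed.

Lemma iter_arrows n s : Nat.iter n (Arr s) N = arrows (repeat s n) N.
Proof. induction n; simpl; congruence. Qed.

Lemma has_type_apps G M ss ps t : has_type G M (arrows ss t) -> Forall2 (has_type G) ps ss ->
  has_type G (apps M ps) t.
Proof.
  intros HM H. revert M HM. induction H; intros M HM; simpl in *; auto.
  apply IHForall2. econstructor; eauto.
Qed.

Lemma apps_arrows_inv G M ss ps : has_type G M (arrows ss N) -> has_type G (apps M ps) N ->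
  Forall2 (has_type G) ps ss.
Proof.
  revert M ps. induction ss as [|s ss IH]; intros M [|p ps] HM H; simpl in *.
  - constructor.
  - destruct (apps_type _ _ _ _ H) as (t & Ht & _). inversion Ht; subst.
    pose proof (has_type_unique _ _ _ HM _ H3). discriminate.
  - pose proof (has_type_unique _ _ _ HM _ H). discriminate.
  - destruct (apps_type _ _ _ _ H) as (t & Ht & _). inversion Ht; subst.
    pose proof (has_type_unique _ _ _ HM _ H3) as E. injection E as <- <-.
    constructor; auto. eapply IH; eauto.
Qed.

(** Divergence is rendered by a query to the nowhere defined oracle rather than by a fixed point: at
    ground type the term is stuck at once, with no infinite reduction to analyse. *)
Fixpoint bot (t : ty) : tm :=
  match t with
  | N => App (Orc (fun _ => None)) (Num 0)
  | Arr s t => Lam s (bot t)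
  end.

Lemma bot_type t : closed_of (bot t) t.
Proof.
  induction t; simpl.
  - repeat econstructor.
  - constructor. now apply closed_weaken.
Qed.

Lemma bot_evalN ps : forall t n, closed_of (apps (bot t) ps) N -> ~ evalN (apps (bot t) ps) n.
Proof.
  induction ps as [|p ps IH]; intros t n H E; simpl in *.
  - assert (t = N) by (eapply has_type_unique; [apply bot_type | apply H]). subst.
    revert E. apply stuck_evalN. exists [], (fun _ => None), 0. auto.
  - destruct (apps_type _ _ _ _ H) as (t' & Ht & Happ). inversion Ht; subst.
    assert (Et := has_type_unique _ _ _ (bot_type t) _ H3). subst t.
    apply (IH t' n).
    + apply Happ, bot_type.
    + eapply evalN_steps; [|exact E]. apply steps_apps. simpl.
      econstructor; [constructor|].
      unfold subst0. rewrite (subst_closed _ _ _ (bot_type t')). constructor.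
Qed.

(** * Sublevels of argument types and of [rho] *)

Lemma sublevel_le_arr s t k l : sublevel_le (Arr s t) k l ->
  exists k', k = S k' /\ sublevel_le s k' l /\ sublevel_le t k l.
Proof.
  unfold sublevel_le. cbn [sublevel lv]. unfold width. cbn [arity wargs]. intros H.
  destruct k as [|k]; [lia|]. exists k. split; auto.
  split; [destruct s | destruct t]; cbn [sublevel]; auto; unfold width; lia.
Qed.

Lemma sublevel_le_S s k l : sublevel_le s k l -> sublevel_le s (S k) l.
Proof. unfold sublevel_le. destruct (sublevel s) as [[]|]; auto. lia. Qed.

Lemma sublevel_le_0 s l : sublevel_le s 0 l -> s = N.
Proof. destruct s; auto. intros H. apply sublevel_le_arr in H as (? & ? & _). discriminate. Qed.

Lemma sublevel_le_1_arity s l : sublevel_le s 1 l -> arity s <= l.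
Proof.
  destruct s; simpl; [lia|]. unfold sublevel_le. cbn [sublevel lv]. unfold width.
  cbn [arity wargs]. lia.
Qed.

Lemma lv_rho k l : lv (rho k (S l)) = k.
Proof.
  destruct k; auto.
  assert (H : forall k n, lv (rho k (S l)) = k -> lv (Nat.iter (S n) (Arr (rho k (S l))) N) = S k).
  { intros k' n H. induction n; cbn [Nat.iter nat_rect lv] in *; rewrite H in *; [lia|].
    unfold Nat.iter in IHn. rewrite IHn. lia. }
  induction k; apply H; auto.
Qed.

Lemma arity_arrows ss : arity (arrows ss N) = length ss.
Proof. induction ss; simpl; auto. Qed.

Lemma rho_S k l : rho (S k) l = arrows (repeat (rho k l) l) N.
Proof. apply iter_arrows. Qed.

(** The level is exactly [k + 1], and the [l + 1] arguments exceed the width [l]. *)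
Lemma rho_sublevel k l : ~ sublevel_le (rho (S k) (S l)) (S k) l.
Proof.
  pose proof (lv_rho (S k) l) as Hl.
  assert (Ha : arity (rho (S k) (S l)) = S l).
  { now rewrite rho_S, arity_arrows, repeat_length. }
  unfold sublevel_le. destruct (rho (S k) (S l)) eqn:E; [discriminate|].
  cbn [sublevel]. rewrite Hl. unfold width. rewrite Ha. lia.
Qed.

(** * Two-sided typing *)

Section TwoSides.

Variables k l : nat.

Local Notation A := (rho k (S l)).
Local Notation Tz := (arrows (repeat A (S l)) N).
Local Notation G := (Tz :: repeat A (S l)).

(* [Xs] is the side of the retraction [r], which knows the arguments [x_0, ..., x_l];
   [Zs ws] is the side of the sections [t_j], which knows [z].  In the ground case [k = 0]
   the terms received from the other side are reducts of members of [ws]. *)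
Inductive side : Type := Xs | Zs (ws : list tm).

Definition to_z (ws : list tm) (M : tm) (s : ty) : Prop :=
  sublevel_le s k l /\
  (k = 0 -> exists w, In w ws /\ has_type G w N /\ steps w M).

(** A budget for the ground case: the terms already received, plus the ground arguments that a term
    crossing to [Xs] can still take, never exceed [l]. *)
Definition to_x (ws : list tm) (s : ty) : Prop :=
  sublevel_le s (S k) l /\ (k = 0 -> length ws + arity s <= l).

(** [sw_refl] stays on the same side; combined with [ct_switch] it yields weakening of a term free
    of local variables. *)
Inductive switch : side -> side -> tm -> ty -> Prop :=
| sw_refl c M s : switch c c M s
| sw_z ws M s : to_z ws M s -> switch Xs (Zs ws) M s
| sw_x ws M s : to_x ws s -> switch (Zs ws) Xs M s.

(* [ct c L M t]: the context of [M] is [L ++ G], where [L] types the variables bound by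
   the surrounding abstractions, which belong to the current side [c]. *)
Inductive ct : side -> list ty -> tm -> ty -> Prop :=
| ct_loc c L i s : nth_error L i = Some s -> ct c L (Var i) s
| ct_z ws L : ct (Zs ws) L (Var (length L + 0)) Tz
| ct_x L i : i < S l -> ct Xs L (Var (length L + S i)) A
| ct_lam c L s t b : ct c (s :: L) b t -> ct c L (Lam s b) (Arr s t)
| ct_app c L s t a b : ct c L a (Arr s t) -> ct c L b s -> ct c L (App a b) t
| ct_num c L n : ct c L (Num n) N
| ct_suc c L : ct c L Suc (Arr N N)
| ct_pre c L : ct c L Pre (Arr N N)
| ct_ifz c L : ct c L Ifz (Arr N (Arr N (Arr N N)))
| ct_Y c L s : ct c L (Yc s) (Arr (Arr s s) s)
| ct_orc c L f : ct c L (Orc f) (Arr N N)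
| ct_switch c' c L M s : ct c' [] M s -> switch c' c M s ->
    ct c L (ren (Nat.add (length L)) M) s.

Lemma ct_has_type c L M t : ct c L M t -> has_type (L ++ G) M t.
Proof.
  induction 1; try (econstructor; eauto; fail).
  - constructor. rewrite nth_error_app1; auto. apply nth_error_Some. congruence.
  - constructor. rewrite nth_error_app2 by lia. now replace (_ - _) with 0 by lia.
  - constructor. rewrite nth_error_app2 by lia. replace (_ - _) with (S i) by lia.
    change (nth_error (repeat A (S l)) i = Some A). now apply nth_error_repeat.
  - eapply has_type_ren; eauto. simpl. intros i s' E.
    rewrite nth_error_app2 by lia. now replace (_ - _) with i by lia.
Qed.

Lemma has_type_ct c L M t : has_type L M t -> ct c L M t.
Proof. induction 1; econstructor; eauto. Qed.

Lemma ct_switch_nil c' c M s : ct c' [] M s -> switch c' c M s -> ct c [] M s.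
Proof.
  intros H Hs. rewrite <- (ren_id M (Nat.add 0)) by auto. eapply (ct_switch _ _ []); eauto.
Qed.

Definition side_le (c d : side) : Prop :=
  match c, d with
  | Xs, Xs => True
  | Zs ws, Zs ws' => incl ws ws'
  | _, _ => False
  end.

Lemma side_le_refl c : side_le c c.
Proof. destruct c; simpl; auto. apply incl_refl. Qed.

(** Growth of [ws] only has to preserve [to_z], which asks for membership. A [Zs] term beneath an
    [Xs] side keeps its own list, so its budget is untouched. *)
Lemma switch_le c' c d M s : switch c' c M s -> side_le c d ->
  exists d', side_le c' d' /\ switch d' d M s.
Proof.
  destruct 1 as [c M s|ws M s [H1 H2]|ws M s H]; intros Hd.
  - exists d. split; auto. constructor.
  - destruct d as [|ws']; [easy|]. exists Xs. split; simpl; auto. constructor.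
    split; auto. intros Hk. destruct (H2 Hk) as (w & Hw & ?). eauto.
  - destruct d; [|easy]. exists (Zs ws). split; [apply side_le_refl|]. now constructor.
Qed.

Lemma ct_le c L M t : ct c L M t -> forall d, side_le c d -> ct d L M t.
Proof.
  induction 1; intros d Hd; try (econstructor; eauto; fail).
  - destruct d; [easy|apply ct_z].
  - destruct d; [now apply ct_x|easy].
  - destruct (switch_le _ _ _ _ _ H0 Hd) as (d' & Hd' & Hs).
    eapply (ct_switch d'); eauto.
Qed.

Fixpoint upn (n : nat) (s : nat -> tm) : nat -> tm :=
  match n with 0 => s | S n => up (upn n s) end.

Lemma upn_lt n s i : i < n -> upn n s i = Var i.
Proof.
  revert i. induction n; intros [|i] H; simpl; auto; try lia.
  rewrite IHn by lia. auto.
Qed.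

Lemma upn_ge n s i : upn n s (n + i) = ren (Nat.add n) (s i).
Proof.
  induction n; simpl.
  - symmetry. now apply ren_id.
  - rewrite IHn, ren_ren. now apply ren_ext.
Qed.

(** A subterm behind [ct_switch] is free of local variables, so the substitution does not affect it.
    Therefore [u] needs a typing on the current side only. *)
Lemma ct_subst c L s b t u : ct c (L ++ [s]) b t -> ct c [] u s ->
  ct c L (subst (upn (length L) (env [u])) b) t.
Proof.
  remember (L ++ [s]) as L' eqn:EL. intros H. revert L EL.
  induction H; intros L0 -> Hu; simpl; try (econstructor; eauto; fail).
  - destruct (Nat.lt_ge_cases i (length L0)).
    + rewrite upn_lt by auto. constructor. now rewrite nth_error_app1 in H.
    + rewrite nth_error_app2 in H by auto.
      destruct (i - length L0) as [|j] eqn:Ei; [|destruct j; discriminate].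
      replace i with (length L0 + 0) by lia. rewrite upn_ge. simpl in *.
      injection H as ->. eapply ct_switch; eauto. constructor.
  - rewrite length_app. simpl. replace (_ + 0) with (length L0 + 1) by lia.
    rewrite upn_ge. apply ct_z.
  - rewrite length_app. simpl. replace (_ + S i) with (length L0 + S (S i)) by lia.
    rewrite upn_ge. replace (env [u] (S (S i))) with (Var (S i)) by (destruct i; auto).
    now apply ct_x.
  - rewrite subst_ren. rewrite (subst_ext _ _ (fun i => ren (Nat.add (length L0)) (Var i))).
    + rewrite <- ren_subst, subst_id by auto. eapply ct_switch; eauto.
    + intros i. rewrite length_app. simpl.
      replace (length L0 + 1 + i) with (length L0 + S i) by lia.
      rewrite upn_ge. destruct i; simpl; auto.
Qed.

(* An argument [u] that crosses to the [Zs ws] side enters the list [ws], which the drop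
   in arity pays for. *)
Lemma ct_beta c M t' : ct c [] M t' -> forall s b t d u, M = Lam s b -> t' = Arr s t ->
  side_le c d -> ct d [] u s -> ct d [] (subst0 u b) t.
Proof.
  remember [] as L eqn:EL. induction 1; intros s0 b0 t0 d u EM Et Hd Hu;
    subst; try discriminate.
  - injection EM as -> ->. injection Et as ->. rewrite subst0_env.
    apply (ct_subst d [] s0); auto. eapply ct_le; eauto.
  - simpl in EM. rewrite ren_id in EM by auto. subst M.
    inversion H0 as [c1 M1 s1|ws M1 s1 Hz|ws M1 s1 Hx]; subst.
    + eapply IHct; eauto.
    + destruct d as [|ws']; [easy|].
      (* An arrow type of sublevel at most [(k, l)] forces [k] to be a successor, so the ground
         clauses are void. The argument crosses back to [Xs], its bound being two levels below what
         [to_x] allows. *)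
      destruct Hz as [Hz _]. apply sublevel_le_arr in Hz as (k' & Hk & H1 & H2).
      apply (ct_switch_nil Xs).
      * eapply IHct; eauto; [apply side_le_refl|]. eapply ct_switch_nil; eauto.
        constructor. split; [|lia]. apply sublevel_le_S. rewrite Hk. now apply sublevel_le_S.
      * constructor. split; auto. lia.
    + destruct d; [|easy]. destruct Hx as [Hx1 Hx2].
      apply sublevel_le_arr in Hx1 as (k' & Hk & H1 & H2). injection Hk as <-.
      apply (ct_switch_nil (Zs (u :: ws))).
      * eapply IHct; eauto; [simpl; apply incl_tl, incl_refl|].
        apply (ct_switch_nil Xs); auto. constructor. split; auto.
        intros Hk. exists u. split; [simpl; auto|]. split; [|constructor].
        rewrite Hk in H1. apply sublevel_le_0 in H1. subst. apply (ct_has_type _ _ _ _ Hu).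
      * constructor. split; auto. simpl in *. intros Hk. specialize (Hx2 Hk). lia.
Qed.

Lemma to_x_N ws s : to_x ws s -> to_x ws N.
Proof. intros [_ H]. split; [exact I|]. simpl. intros Hk. specialize (H Hk). lia. Qed.

(** The partial application may have crossed as a whole at type [N -> N]. The branch then crosses by
    itself at type [N], which costs no more. *)
Lemma ct_ifz_branch c M0 t : ct c [] M0 t -> forall a M, M0 = App (App Ifz a) M ->
  ct c [] M N.
Proof.
  remember [] as L eqn:EL. induction 1; intros a0 M0 EM; subst; try discriminate.
  - injection EM as -> ->. apply ct_has_type in H. inversion H; subst.
    inversion H4; subst. auto.
  - simpl in EM. rewrite ren_id in EM by auto. subst M.
    assert (HM := IHct eq_refl _ _ eq_refl).
    assert (s = Arr N N).
    { apply ct_has_type in H. inversion H; subst. inversion H4; subst. inversion H5; auto. }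
    subst s. apply (ct_switch_nil c'); auto.
    inversion H0 as [c1 M1 s1|ws M1 s1 Hz|ws M1 s1 Hx]; subst.
    + constructor.
    + destruct Hz as [Hz _]. apply sublevel_le_arr in Hz as (k' & Hk & _).
      constructor. split; [exact I|]. lia.
    + constructor. eapply to_x_N; eauto.
Qed.

Lemma switch_step c' c M M' s : switch c' c M s -> step M M' -> switch c' c M' s.
Proof.
  destruct 1 as [c M s|ws M s [H1 H2]|ws M s Hx]; intros St; constructor; auto.
  split; auto. intros Hk. destruct (H2 Hk) as (w & ? & ? & ?). exists w.
  repeat split; auto. eapply steps_trans; eauto. econstructor; eauto. constructor.
Qed.

(** Subject reduction for the two sides. Beta and the first branch of [ifzero] release a part of a
    compound term that may have crossed, hence their separate lemmas; the other contractions only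
    rearrange immediate subterms or produce numerals. *)
Lemma ct_step c M t : ct c [] M t -> forall M', step M M' -> ct c [] M' t.
Proof.
  remember [] as L eqn:EL. induction 1; intros M' St; subst; try (inversion St; fail).
  - assert (HT := ct_has_type _ _ _ _ H). specialize (IHct1 eq_refl).
    specialize (IHct2 eq_refl).
    inversion St; subst; try (eapply ct_app; eauto; fail).
    + inversion HT; subst. eapply ct_beta; eauto. apply side_le_refl.
    + inversion HT; subst. eapply ct_app; eauto. eapply ct_app; eauto.
    + inversion HT; subst. constructor.
    + inversion HT; subst. constructor.
    + inversion HT; subst. inversion H4; subst. inversion H5; subst.
      eapply ct_ifz_branch; [exact H | reflexivity].
    + inversion HT; subst. inversion H4; subst. inversion H5; subst. auto.
    + inversion HT; subst. constructor.
  - simpl in St. rewrite ren_id in St by auto.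
    eapply ct_switch_nil; [apply IHct; eauto|]. eapply switch_step; eauto.
Qed.

(** In the ground case, a [Zs ws] side is open when at most [l] terms have been received. Every side
    entered by a crossing along the head path is open, since [to_x] already bounds [ws]. *)
Definition open_side (c : side) : Prop :=
  match c with Xs => True | Zs ws => to_x ws N end.

Lemma ct_app_inv c M t : ct c [] M t -> open_side c -> forall a b, M = App a b ->
  exists c' s, ct c' [] a (Arr s t) /\ ct c' [] b s /\ open_side c'.
Proof.
  remember [] as L eqn:EL. induction 1; intros Hc a0 b0 EM; subst; try discriminate.
  - injection EM as -> ->. eauto.
  - simpl in EM. rewrite ren_id in EM by auto. apply IHct; auto.
    destruct H0; simpl; auto. eapply to_x_N; eauto.
Qed.

Lemma apps_var_inv i ps M : M = apps (Var i) ps ->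
  (ps = [] /\ M = Var i) \/
  exists ps' b, ps = ps' ++ [b] /\ M = App (apps (Var i) ps') b.
Proof.
  intros ->. destruct ps as [|b ps _] using rev_ind; auto.
  right. exists ps, b. now rewrite apps_snoc.
Qed.

(** A call of [z] can be distributed: [qs] is supplied on the [Zs ws] side, before a partial
    application crosses, and [rest] afterwards. For [k = 0] the last clause reads
    [length ws + (S l - length qs) <= l], that is, fewer terms have been received than arguments
    built. *)
Definition z_args (ps : list tm) : Prop :=
  exists ws qs rest, ps = qs ++ rest /\ Forall (fun q => ct (Zs ws) [] q A) qs /\
    1 <= length qs <= S l /\ to_x ws (arrows (repeat A (S l - length qs)) N).

Lemma ct_spine_inv c M t : ct c [] M t -> forall ps, M = apps (Var 0) ps ->
  (exists ws, c = Zs ws /\ Forall (fun q => ct (Zs ws) [] q A) ps /\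
     length ps <= S l /\ t = arrows (repeat A (S l - length ps)) N) \/ z_args ps.
Proof.
  remember [] as L eqn:EL. induction 1; intros ps EM; subst;
    try (lazymatch type of EM with ren _ _ = _ => fail | _ => idtac end;
      apply apps_var_inv in EM as [[-> EM]|(ps' & b' & -> & EM)]; try discriminate).
  - destruct i; discriminate.
  - left. exists ws. split; [auto|]. split; [constructor|]. split; [simpl; lia|reflexivity].
  - injection EM as -> ->.
    destruct (IHct1 eq_refl _ eq_refl) as [(ws & -> & Hps & Hlen & Et)|
      (ws & qs & rest & -> & Hqs)].
    + left. exists ws. rewrite length_app. cbn [length].
      destruct (S l - length ps') as [|m] eqn:Em; [discriminate|].
      simpl in Et. injection Et as -> ->.
      repeat split; auto.
      * apply Forall_app. auto.
      * lia.
      * f_equal. f_equal. lia.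
    + right. exists ws, qs, (rest ++ [b']). now rewrite app_assoc.
  - simpl in EM. rewrite ren_id in EM by auto. subst M.
    destruct (IHct eq_refl _ eq_refl) as [(ws & -> & Hps & Hlen & Et)|Hz]; auto.
    inversion H0 as [c1 M1 s1| |ws1 M1 s1 H1]; subst; [left; exists ws; auto|].
    destruct ps as [|p ps].
    (* [z] without arguments cannot cross: its type [rho (S k) (S l)] lies beyond the sublevel that
       [to_x] allows. Hence [qs] is nonempty. *)
    + exfalso. apply (rho_sublevel k l). destruct H1 as [H1 _].
      rewrite rho_S. exact H1.
    + right. exists ws, (p :: ps), []. rewrite app_nil_r.
      repeat split; auto; simpl; try lia; apply H1.
Qed.

(** When all arguments are supplied on a single [Zs ws] side, no crossing certifies the budget; it
    comes from the open side instead. *)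
Lemma ct_blocked E : forall c ps t, ct c [] (fill E (apps (Var 0) ps)) t -> open_side c ->
  has_type G (apps (Var 0) ps) N -> z_args ps.
Proof.
  induction E as [|F E IH]; simpl; intros c ps t H Hc HT.
  - assert (t = N) by (eapply has_type_unique; [apply (ct_has_type _ _ _ _ H) | exact HT]).
    destruct (ct_spine_inv _ _ _ H _ eq_refl) as [(ws & -> & Hps & Hlen & Et)|]; auto.
    exists ws, ps, []. rewrite app_nil_r.
    destruct (S l - length ps) eqn:El; [|subst; discriminate].
    repeat split; auto; try lia; apply Hc.
  - destruct F; simpl in H;
      destruct (ct_app_inv _ _ _ H Hc _ _ eq_refl) as (c' & s & Ha & Hb & Hc'); eauto.
Qed.

(** Cut the term where it switches to [Xs]. The pieces [us] contain no local variables and become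
    parameters of a context [R] that knows [z] but none of the [x_i]. The parameters [us0] are
    reserved for a part already cut, so that both halves of an application can share one list. *)
Lemma ct_factor c L M t : ct c L M t -> forall ws, c = Zs ws ->
  forall us0 ss0, length us0 = length ss0 -> exists us ss R,
    Forall2 (fun u s => has_type G u s /\ to_z ws u s) us ss /\
    has_type (L ++ Tz :: ss0 ++ ss) R t /\
    M = subst (upn (length L) (env (Var 0 :: us0 ++ us))) R.
Proof.
  induction 1; intros ws0 Ec us0 ss0 H00; subst;
    try (exists [], []; eexists; split; [constructor|split];
      [constructor | reflexivity]; fail).
  - exists [], [], (Var i). split; [constructor|]. assert (i < length L) by
      (apply nth_error_Some; congruence). split.
    + constructor. now rewrite nth_error_app1.
    + simpl. now rewrite upn_lt.
  - exists [], [], (Var (length L + 0)). split; [constructor|]. split.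
    + constructor. rewrite nth_error_app2 by lia. now replace (_ - _) with 0 by lia.
    + simpl subst. now rewrite upn_ge.
  - discriminate.
  - destruct (IHct _ eq_refl _ _ H00) as (us & ss & R & H1 & H2 & ->).
    exists us, ss, (Lam s R). split; auto. split; auto. now constructor.
  - destruct (IHct1 _ eq_refl _ _ H00) as (us & ss & R & H1 & H2 & ->).
    assert (H01 := Forall2_length H1).
    destruct (IHct2 _ eq_refl (us0 ++ us) (ss0 ++ ss)) as (us' & ss' & R' & H1' & H2' & ->).
    { rewrite !length_app. lia. }
    exists (us ++ us'), (ss ++ ss'), (App R R'). split; [|split].
    + now apply Forall2_app.
    + rewrite <- app_assoc in H2'. econstructor; eauto.
      apply (has_type_app_ctx _ ss') in H2. rewrite <- app_assoc in H2. simpl in H2.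
      now rewrite <- app_assoc in H2.
    + rewrite <- app_assoc. simpl. f_equal.
      (* Appending parameters does not affect [R], which refers only to the earlier ones. *)
      apply (subst_agree _ _ _ H2). intros i Hi. rewrite length_app in Hi. simpl in Hi.
      rewrite length_app in Hi. destruct (Nat.lt_ge_cases i (length L)).
      { now rewrite !upn_lt. }
      replace i with (length L + (i - length L)) by lia. rewrite !upn_ge. f_equal.
      unfold env. destruct (i - length L) as [|j] eqn:Ej; auto. simpl.
      rewrite (app_assoc us0), (app_nth1 (us0 ++ us)) by (rewrite length_app; lia).
      apply nth_indep. rewrite length_app; lia.
  - inversion H0; subst.
    + destruct (IHct _ eq_refl _ _ H00) as (us & ss & R & H1 & H2 & ->).
      exists us, ss, (ren (Nat.add (length L)) R). split; auto. split.
      * eapply has_type_ren; eauto. intros i s' Hi. simpl in Hi.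
        rewrite nth_error_app2 by lia. now replace (_ - _) with i by lia.
      * rewrite ren_subst, subst_ren. apply subst_ext. intros i. now rewrite upn_ge.
    + exists [M], [s], (Var (length L + S (length ss0))). split; [|split].
      * constructor; auto. split; auto. apply (ct_has_type _ _ _ _ H).
      * constructor. rewrite nth_error_app2 by lia.
        replace (_ - _) with (S (length ss0)) by lia. simpl.
        rewrite nth_error_app2 by lia. now rewrite Nat.sub_diag.
      * simpl. rewrite upn_ge. unfold env. simpl.
        now rewrite <- H00, app_nth2, Nat.sub_diag by lia.
Qed.

Lemma ct_factor_nil ws M t : ct (Zs ws) [] M t -> exists us ss R,
    Forall2 (fun u s => has_type G u s /\ to_z ws u s) us ss /\
    has_type (Tz :: ss) R t /\ M = subst (env (Var 0 :: us)) R.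
Proof. intros H. exact (ct_factor _ _ _ _ H _ eq_refl [] [] eq_refl). Qed.

End TwoSides.

(** * Calls of [z] in a pseudo-retraction *)

Lemma map_subst_closed G xs ss s : Forall2 closed_of xs ss -> map (subst s) xs = xs /\
  Forall2 (has_type G) xs ss.
Proof.
  induction 1 as [|x t xs ss Hx _ [IH1 IH2]]; simpl; auto.
  split; [f_equal; auto; eapply subst_closed; eauto | auto using closed_weaken].
Qed.

Lemma map_env_seq xs : map (env xs) (seq 0 (length xs)) = xs.
Proof.
  induction xs as [|x xs IH]; auto. cbn [length seq map]. f_equal.
  rewrite <- seq_shift, map_map. exact IH.
Qed.

Lemma Forall2_repeat {X Y} (R : X -> Y -> Prop) x y n : R x y -> Forall2 R (repeat x n) (repeat y n).
Proof. intros H. induction n; simpl; auto. Qed.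

Lemma Forall2_refl {X} (R : X -> X -> Prop) xs : (forall x, R x x) -> Forall2 R xs xs.
Proof. intros H. induction xs; auto. Qed.

Section Calls.

Variables k l : nat.

Local Notation A := (rho k (S l)).
Local Notation Tz := (arrows (repeat A (S l)) N).
Local Notation G := (Tz :: repeat A (S l)).

Definition zconst (n : nat) : tm := lams (repeat A (S l)) (Num n).

Definition is_eq (n m : nat) : option nat := if m =? n then Some 0 else None.

(** The argument number [i] has index [l - i], the last of the [l + 1] being bound innermost. The
    partial oracle makes every outcome other than [n] diverge, which puts the test below
    [zconst 0]. *)
Definition ztest (i : nat) (h : tm) (n : nat) : tm :=
  lams (repeat A (S l)) (App (Orc (is_eq n)) (App h (Var (l - i)))).

Lemma zconst_type n : closed_of (zconst n) Tz.
Proof. apply has_type_lams. constructor. Qed.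

Lemma ztest_type i h n : i < S l -> closed_of h (Arr A N) -> closed_of (ztest i h n) Tz.
Proof.
  intros Hi Hh. apply has_type_lams. econstructor; [constructor|].
  econstructor; [apply closed_weaken, Hh|]. constructor.
  rewrite app_nil_r, rev_repeat. apply nth_error_repeat. lia.
Qed.

Lemma zconst_steps n ps : length ps = S l -> steps (apps (zconst n) ps) (Num n).
Proof. intros H. apply steps_lams_closed. now rewrite repeat_length. Qed.

Lemma ztest_steps i h n ps p : length ps = S l -> nth_error ps i = Some p ->
  closed_of h (Arr A N) ->
  steps (apps (ztest i h n) ps) (App (Orc (is_eq n)) (App h p)).
Proof.
  intros Hl Hp Hh. assert (i < length ps) by (apply nth_error_Some; congruence).
  pose proof (steps_lams_closed (repeat A (S l)) ps
    (App (Orc (is_eq n)) (App h (Var (l - i))))) as Hst.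
  simpl subst in Hst. rewrite (subst_closed _ _ _ Hh), (env_nth _ _ p) in Hst.
  - apply Hst. now rewrite repeat_length.
  - rewrite nth_error_rev. destruct (Nat.ltb_spec (l - i) (length ps)); [|lia].
    now replace (length ps - S (l - i)) with i by lia.
Qed.

Lemma is_eq_evalN M n m : closed_of M N -> evalN (App (Orc (is_eq n)) M) m ->
  evalN M n /\ m = 0.
Proof.
  intros HM H. destruct (evalN_fill [FOrc (is_eq n)] _ _ HM H) as (m' & H1 & H2).
  simpl in H2. inversion H2 as [|M1 M2 M3 St Hs]; subst.
  inversion St; subst;
    try (match goal with X : step (Orc _) _ |- _ => inversion X
                       | X : step (Num _) _ |- _ => inversion X end).
  match goal with X : is_eq _ _ = _ |- _ => unfold is_eq in X; rename X into E end.
  destruct (Nat.eqb_spec m' n); [|discriminate]. injection E as <-. subst.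
  split; auto. symmetry. eapply evalN_det; [constructor | exact Hs].
Qed.

Lemma ztest_le i h n : i < S l -> closed_of h (Arr A N) ->
  app_le (ztest i h n) (zconst 0).
Proof.
  intros Hi Hh ps m HT E.
  assert (Hps := apps_arrows_inv _ _ _ _ (ztest_type i h n Hi Hh) HT).
  assert (Hlen := Forall2_length Hps). rewrite repeat_length in Hlen.
  destruct (Forall2_nth _ _ _ i A Hps) as (p & Hp & Htp).
  { now apply nth_error_repeat. }
  apply (evalN_steps _ _ _ (ztest_steps _ _ _ _ _ Hlen Hp Hh)) in E.
  apply is_eq_evalN in E as [_ ->]; [|econstructor; eauto].
  now apply zconst_steps.
Qed.

Section Retraction.

Variables (ss : list ty) (ts : list tm) (r : tm).
Hypothesis Hss : forall s, In s ss -> sublevel_le s (S k) l.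
Hypothesis Hts : Forall2 (fun t s => closed_of t (Arr Tz s)) ts ss.
Hypothesis Hr : closed_of r (arrows ss Tz).
Hypothesis Hret : forall f, closed_of f Tz -> sf_le Tz f (apps r (map (fun t => App t f) ts)).

Let e := apps (apps r (map (fun t => App t (Var 0)) ts)) (map Var (seq 1 (S l))).

(** The order at type [Tz] is observed through the functional that applies its argument to [xs]. *)
Lemma retraction_instance z xs n : closed_of z Tz ->
  Forall2 closed_of xs (repeat A (S l)) -> evalN (apps z xs) n ->
  evalN (subst (env (z :: xs)) e) n.
Proof.
  intros Hz Hxs Hev.
  assert (Hlen := Forall2_length Hxs). rewrite repeat_length in Hlen.
  assert (Ee : subst (env (z :: xs)) e = apps (apps r (map (fun t => App t z) ts)) xs).
  { unfold e. rewrite !subst_apps, (subst_closed _ _ _ Hr), !map_map. f_equal; [f_equal|].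
    - clear -Hts. induction Hts; simpl; auto. rewrite (subst_closed _ _ _ H).
      f_equal. auto.
    - rewrite <- Hlen, <- seq_shift, map_map. apply map_env_seq. }
  rewrite Ee. set (h := Lam Tz (apps (Var 0) xs)).
  assert (Hb : forall M, steps (App h M) (apps M xs)).
  { intros M. econstructor; [constructor|]. unfold subst0. rewrite subst_apps.
    rewrite (proj1 (map_subst_closed [] _ _ _ Hxs)). constructor. }
  eapply evalN_steps; [apply Hb|]. apply (Hret z Hz).
  - constructor. eapply has_type_apps.
    + now constructor.
    + apply (map_subst_closed _ _ _ Var Hxs).
  - eapply steps_trans; [apply Hb | exact Hev].
Qed.

(** [r] and the [x_i] live on the [Xs] side. Each [t_j z] starts on [Zs []], with nothing received,
    and crosses at type [sigma_j], whose arity is at most [l] in the ground case. *)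
Lemma retraction_ct : ct k l Xs [] e N.
Proof.
  assert (H : forall M t ps us, ct k l Xs [] M (arrows us t) ->
    Forall2 (ct k l Xs []) ps us -> ct k l Xs [] (apps M ps) t).
  { intros M t ps us HM Hps. revert M HM. induction Hps; intros M HM; simpl in *; auto.
    apply IHHps. econstructor; eauto. }
  unfold e. eapply H; [eapply H|].
  - apply has_type_ct. exact Hr.
  - clear -Hss Hts. induction Hts as [|t s ts' ss' Ht Hts' IH]; simpl; constructor.
    + apply (ct_switch_nil k l (Zs [])).
      * econstructor; [apply has_type_ct; exact Ht|]. apply (ct_z k l [] []).
      * assert (Hs : sublevel_le s (S k) l) by (apply Hss; simpl; auto).
        constructor. split; auto. intros Hk. simpl. apply sublevel_le_1_arity.
        now rewrite <- Hk at 1.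
    + apply IH; auto. intros s' Hs'. apply Hss. simpl; auto.
  - assert (Hx : forall n m, n + m <= S l ->
      Forall2 (ct k l Xs []) (map Var (seq (S n) m)) (repeat A m)).
    { intros n m. revert n. induction m; intros n Hn; simpl; constructor.
      - apply (ct_x k l []). lia.
      - apply IHm. lia. }
    apply Hx. lia.
Qed.

Let bots := repeat (bot A) (S l).

Lemma bots_type : Forall2 closed_of bots (repeat A (S l)).
Proof. apply Forall2_repeat, bot_type. Qed.

(** Two constants are compared: a reduction ending in a numeral without calling [z] would give the
    same result for [z] constantly 0 and constantly 1. Nor can it wait for an [x_i], as these
    diverge. *)
Lemma retraction_calls_z : exists E ps, steps e (fill E (apps (Var 0) ps)) /\
  has_type G (apps (Var 0) ps) N /\ z_args k l ps.
Proof.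
  assert (Hb := bots_type).
  assert (Hc : forall n, evalN (subst (env (zconst n :: bots)) e) n).
  { intros n. apply retraction_instance; auto using zconst_type.
    apply zconst_steps, repeat_length. }
  assert (H1 := Hc 1). destruct (evalN_evaln _ _ (Hc 0)) as [j Hj].
  assert (He := retraction_ct). revert Hj H1 He. generalize e as M.
  induction j as [j IH] using (well_founded_induction lt_wf). intros M Hj H1 HM.
  assert (HT := ct_has_type _ _ _ _ _ _ HM).
  destruct (progress _ _ HT) as [[n ->]|[[M' S]|[S|(E & i & ps & -> & Hps)]]].
  - apply evaln_evalN in Hj. exfalso.
    assert (H0 : 0 = n) by (eapply evalN_det; [exact Hj | constructor]).
    assert (H1' : 1 = n) by (eapply evalN_det; [exact H1 | constructor]). lia.
  - destruct (evaln_inv_step _ _ _ _ Hj (step_subst _ _ _ S)) as (j' & -> & Hj').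
    destruct (IH j' ltac:(lia) M') as (E & ps & St & ?); auto.
    + eapply evalN_steps; [|exact H1]. econstructor; [apply step_subst, S|constructor].
    + eapply ct_step; eauto.
    + exists E, ps. split; auto. econstructor; eauto.
  - exfalso. eapply stuck_evalN; [apply stuck_subst, S | exact H1].
  - destruct i as [|i].
    + exists E, ps. split; [constructor|]. split; auto.
      eapply ct_blocked; eauto. exact I.
    + exfalso. rewrite subst_fill in H1.
      assert (HP : closed_of (subst (env (zconst 1 :: bots)) (apps (Var (S i)) ps)) N).
      { eapply has_type_env; [|exact Hps]. constructor; auto. apply zconst_type. }
      destruct (evalN_fill _ _ _ HP H1) as (m & Hm & _).
      destruct (apps_type _ _ _ _ Hps) as (t & Ht & _).
      inversion Ht as [G0 i0 s0 Hn| | | | | | | |]; subst.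
      rewrite subst_apps in HP, Hm. simpl subst in HP, Hm.
      assert (Hi : S i < length G) by (apply nth_error_Some; intros Hx; cbn [app] in Hn; congruence).
      cbn [length] in Hi. rewrite repeat_length in Hi.
      assert (Hx : env (zconst 1 :: bots) (S i) = bot A).
      { apply env_nth. apply (nth_error_repeat (bot A)). lia. }
      rewrite Hx in HP, Hm. eapply bot_evalN; eauto.
Qed.

(** The reduction of the open term [e] to a call of [z] is fixed before any instance is chosen, so
    it can be replayed with [ztest i h n] for [z]. The call must then return, so its argument number
    [i] passes the test. *)
Lemma retraction_factor : exists ws qs,
  Forall (fun q => ct k l (Zs ws) [] q A) qs /\
  1 <= length qs <= S l /\
  to_x k l ws (arrows (repeat A (S l - length qs)) N) /\
  forall i q xs x h n, nth_error qs i = Some q ->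
    Forall2 closed_of xs (repeat A (S l)) -> nth_error xs i = Some x ->
    closed_of h (Arr A N) -> evalN (App h x) n ->
    evalN (App h (subst (env (zconst 0 :: xs)) q)) n.
Proof.
  destruct retraction_calls_z as (E & ps & Hst & Hps & ws & qs & rest & -> & Hqs & Hlen & Hx).
  exists ws, qs. repeat split; auto; try lia; try apply Hx.
  intros i q xs x h n Hq Hxs Hxi Hh Hev.
  assert (Hil : i < length qs) by (apply nth_error_Some; congruence).
  assert (Hi : i < S l) by lia.
  assert (Hlxs := Forall2_length Hxs). rewrite repeat_length in Hlxs.
  set (zt := ztest i h n). set (sg := env (zt :: xs)).
  assert (Hzt : closed_of zt Tz) by now apply ztest_type.
  assert (He : evalN (subst sg e) 0).
  { apply retraction_instance; auto.
    eapply steps_trans; [apply (ztest_steps _ _ _ _ _ Hlxs Hxi Hh)|].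
    apply (evalN_expand [FOrc (is_eq n)] _ _ _ Hev). econstructor; [|constructor].
    constructor. unfold is_eq. now rewrite Nat.eqb_refl. }
  apply (evalN_steps _ _ _ (steps_subst sg _ _ Hst)) in He.
  rewrite subst_fill in He.
  assert (Henv : Forall2 closed_of (zt :: xs) G) by (constructor; auto).
  assert (HP : closed_of (subst sg (apps (Var 0) (qs ++ rest))) N)
    by (eapply has_type_env; eauto).
  destruct (evalN_fill _ _ _ HP He) as (m & Hm & _).
  rewrite subst_apps in HP, Hm. simpl subst in HP, Hm.
  change (sg 0) with zt in HP, Hm.
  assert (Hl' := Forall2_length (apps_arrows_inv _ _ _ _ Hzt HP)).
  rewrite repeat_length in Hl'.
  assert (Hqi : nth_error (map (subst sg) (qs ++ rest)) i = Some (subst sg q)).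
  { rewrite map_app, nth_error_app1 by now rewrite length_map. now apply map_nth_error. }
  apply (evalN_steps _ _ _ (ztest_steps _ _ _ _ _ Hl' Hqi Hh)) in Hm.
  assert (Hqt : has_type G q A).
  { eapply Forall_forall in Hqs; [|eapply nth_error_In; eauto].
    apply (ct_has_type _ _ _ _ _ _ Hqs). }
  apply is_eq_evalN in Hm as [Hm _].
  2:{ econstructor; [exact Hh|]. eapply has_type_env; eauto. }
  rewrite <- (subst_closed _ _ sg Hh) in Hm.
  rewrite <- (subst_closed _ _ (env (zconst 0 :: xs)) Hh).
  (* The argument still contains the test in place of [z]; monotonicity trades it for the
     constant. *)
  apply (context_lemma_env G (zt :: xs) (zconst 0 :: xs) (App h q)); auto.
  - constructor; auto. apply zconst_type.
  - constructor; [now apply ztest_le|]. apply Forall2_refl, app_le_refl.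
  - econstructor; [apply closed_weaken, Hh | exact Hqt].
Qed.

End Retraction.

End Calls.

(** * The two cases of the induction *)

Lemma subst_env_map D R t us s : has_type D R t -> length us = length D ->
  subst s (subst (env us) R) = subst (env (map (subst s) us)) R.
Proof.
  intros H Hl. rewrite subst_subst. apply (subst_agree _ _ _ H). intros i Hi.
  unfold env. rewrite (nth_indep (map (subst s) us) _ (subst s (Var (i - length us))))
    by (rewrite length_map; lia).
  now rewrite map_nth.
Qed.

Lemma has_type_vars D' D : Forall2 (has_type (D' ++ D)) (map Var (seq (length D') (length D))) D.
Proof.
  revert D'. induction D as [|s D IH]; intros D'; simpl; constructor.
  - constructor. rewrite nth_error_app2 by lia. now rewrite Nat.sub_diag.
  - specialize (IH (D' ++ [s])). rewrite <- app_assoc, length_app, Nat.add_1_r in IH. exact IH.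
Qed.

Lemma Forall2_rev {X Y} (R : X -> Y -> Prop) xs ys :
  Forall2 R xs ys -> Forall2 R (rev xs) (rev ys).
Proof. induction 1; simpl; auto. apply Forall2_app; auto. Qed.

Lemma has_type_rev_vars ss :
  Forall2 (has_type (rev ss)) (map Var (rev (seq 0 (length ss)))) ss.
Proof.
  pose proof (Forall2_rev _ _ _ (has_type_vars [] (rev ss))) as H.
  now rewrite <- map_rev, rev_involutive, length_rev in H.
Qed.

Lemma Forall2_map_l {X X' Y} (f : X -> X') (R : X' -> Y -> Prop) xs ys :
  Forall2 (fun x => R (f x)) xs ys -> Forall2 R (map f xs) ys.
Proof. induction 1; simpl; auto. Qed.

Lemma Forall2_map_same {X X'} (f g : X -> X') (R : X' -> X' -> Prop) xs :
  (forall x, In x xs -> R (f x) (g x)) -> Forall2 R (map f xs) (map g xs).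
Proof. induction xs; simpl; constructor; auto. Qed.

Lemma Forall2_in_l {X Y} (R : X -> Y -> Prop) xs ys x :
  Forall2 R xs ys -> In x xs -> exists y, In y ys /\ R x y.
Proof.
  induction 1; simpl; [easy|]. intros [->|Hx]; eauto.
  destruct (IHForall2 Hx) as (y' & ? & ?). eauto.
Qed.

Lemma Forall2_in_r {X Y} (R : X -> Y -> Prop) xs ys y :
  Forall2 R xs ys -> In y ys -> exists x, In x xs /\ R x y.
Proof.
  induction 1; simpl; [easy|]. intros [->|Hy]; eauto.
  destruct (IHForall2 Hy) as (x' & ? & ?). eauto.
Qed.

(** With [z] constant and all [x_i] but the first divergent, the received terms become functions of
    [x] alone: these are the sections. The context [R] that assembles the argument from them is the
    retraction, and domination gives the inequality. *)
Lemma z_arg_pseudo_retract k l ws q :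
  let A := rho k (S l) in
  ct k l (Zs ws) [] q A ->
  (forall x h n, closed_of x A -> closed_of h (Arr A N) -> evalN (App h x) n ->
    evalN (App h (subst (env (zconst k l 0 :: x :: repeat (bot A) l)) q)) n) ->
  exists ss, (forall s, In s ss -> sublevel_le s k l) /\ pseudo_retract A ss.
Proof.
  intros A Hq Hdom. set (z0 := zconst k l 0). set (bs := repeat (bot A) l).
  set (Tz := arrows (repeat A (S l)) N). set (G := Tz :: repeat A (S l)).
  destruct (ct_factor_nil _ _ _ _ _ Hq) as (us & ss & R & Hus & HR & ->).
  fold Tz G in Hus, HR. assert (Hlen := Forall2_length Hus).
  assert (Hz0 : closed_of z0 Tz) by apply zconst_type.
  assert (Hbs : Forall2 closed_of bs (repeat A l)) by apply Forall2_repeat, bot_type.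
  exists ss. split.
  { intros s Hs. destruct (Forall2_in_r _ _ _ _ Hus Hs) as (u & _ & _ & H & _). exact H. }
  set (e1 := z0 :: Var 0 :: bs).
  (* Indices of the parameters of [lams ss], counted down because the first is bound outermost. *)
  set (vs := map Var (rev (seq 0 (length ss)))).
  exists (map (fun u => Lam A (subst (env e1) u)) us), (lams ss (subst (env (z0 :: vs)) R)).
  assert (He1 : Forall2 (has_type [A]) e1 G).
  { constructor; [apply closed_weaken, Hz0|]. constructor; [now constructor|].
    apply (map_subst_closed _ _ _ Var Hbs). }
  assert (Hts : Forall2 (fun t s => closed_of t (Arr A s))
    (map (fun u => Lam A (subst (env e1) u)) us) ss).
  { apply Forall2_map_l. eapply Forall2_impl; [|exact Hus]. intros u s [Hu _].
    constructor. eapply has_type_env; eauto. }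
  assert (Hr : closed_of (lams ss (subst (env (z0 :: vs)) R)) (arrows ss A)).
  { apply has_type_lams. rewrite app_nil_r. eapply has_type_env; [|exact HR].
    constructor; [apply closed_weaken, Hz0 | apply has_type_rev_vars]. }
  split; [exact Hts|]. split; [exact Hr|].
  intros f Hf h Hh n Hev. apply Hdom in Hev; auto.
  set (ef := z0 :: f :: bs) in *. fold z0 bs in Hev. change (z0 :: f :: bs) with ef in Hev.
  assert (Hef : Forall2 closed_of ef G) by (constructor; [exact Hz0 | constructor; auto]).
  rewrite (subst_env_map (Tz :: ss) _ A) in Hev by (simpl; auto). cbn [map] in Hev.
  change (subst (env ef) (Var 0)) with z0 in Hev.
  rewrite map_map. set (args := map (fun u => App (Lam A (subst (env e1) u)) f) us).
  assert (Hargs : Forall2 closed_of args ss).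
  { apply Forall2_map_l. eapply Forall2_impl; [|exact Hus]. intros u s [Hu _].
    econstructor; [|exact Hf]. constructor. eapply has_type_env; eauto. }
  assert (Hla : length args = length ss) by apply (Forall2_length Hargs).
  (* So far [R] is fed the beta reducts of the sections applied to [f]; the context lemma goes back
     to the unreduced applications. *)
  assert (Hev2 : evalN (App h (subst (env (z0 :: args)) R)) n).
  { rewrite <- (subst_closed _ _ (env (z0 :: args)) Hh).
    apply (context_lemma_env (Tz :: ss) (z0 :: map (subst (env ef)) us) (z0 :: args) (App h R)).
    - constructor; auto. apply Forall2_map_l. eapply Forall2_impl; [|exact Hus].
      intros u s [Hu _]. eapply has_type_env; eauto.
    - constructor; auto.
    - constructor; [apply app_le_refl|]. apply Forall2_map_same. intros u Hu.
      destruct (Forall2_in_l _ _ _ _ Hus Hu) as (s & _ & Hut & _).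
      apply app_le_steps. econstructor; [constructor|]. unfold subst0.
      rewrite (subst_env_map G _ s) by (auto; apply (Forall2_length He1)).
      cbn [map e1]. rewrite (subst_closed _ _ _ Hz0), (proj1 (map_subst_closed [] _ _ _ Hbs)).
      constructor.
    - econstructor; [apply closed_weaken, Hh | exact HR].
    - simpl. now rewrite (subst_closed _ _ _ Hh). }
  assert (Hst : steps (apps (lams ss (subst (env (z0 :: vs)) R)) args)
    (subst (env (z0 :: args)) R)).
  { assert (Hvs : map (subst (env (rev args))) vs = args).
    { unfold vs. rewrite map_map, <- Hla, <- length_rev, map_rev.
      change (rev (map (env (rev args)) (seq 0 (length (rev args)))) = args).
      now rewrite (map_env_seq (rev args)), rev_involutive. }
    pose proof (steps_lams_closed ss args (subst (env (z0 :: vs)) R) Hla) as H.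
    rewrite (subst_env_map (Tz :: ss) _ A) in H.
    - cbn [map] in H. now rewrite (subst_closed _ _ _ Hz0), Hvs in H.
    - exact HR.
    - unfold vs. simpl. now rewrite length_map, length_rev, length_seq. }
  assert (Hcl : closed_of (apps (lams ss (subst (env (z0 :: vs)) R)) args) A)
    by (eapply has_type_apps; [exact Hr | exact Hargs]).
  (* Viewing the test [h] as a context lets the context lemma undo the reduction of the retraction
     as well, although it takes place in argument position. *)
  assert (Hc : forall M, subst (env [M]) (App h (Var 0)) = App h M)
    by (intros M; simpl; now rewrite (subst_closed _ _ _ Hh)).
  rewrite <- Hc. rewrite <- Hc in Hev2. revert Hev2.
  apply (context_lemma_env [A]).
  - constructor; auto. eapply steps_preservation; eauto.
  - constructor; auto.
  - constructor; auto. now apply app_le_steps.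
  - econstructor; [apply closed_weaken, Hh | now constructor].
Qed.

Lemma app_le_N M M' : closed_of M N -> (forall n, evalN M n -> evalN M' n) -> app_le M M'.
Proof.
  intros HM H ps n HT. assert (Hps := apps_arrows_inv [] M [] ps HM HT).
  inversion Hps; subst. apply H.
Qed.

Lemma app_le_bot t M : app_le (bot t) M.
Proof. intros ps n HT E. exfalso. eapply bot_evalN; eauto. Qed.

(* Setting [x_0, x_1, ...] one after the other to a suitable numeral makes a new member of
   [ws] converge each time: otherwise the next argument of [z] could not tell whether the
   next [x_i] is set to [0] or to [1]. *)
Lemma ground_contradiction l ws qs :
  Forall (fun q => ct 0 l (Zs ws) [] q N) qs -> length ws < length qs <= S l ->
  (forall i q xs x h n, nth_error qs i = Some q ->
    Forall2 closed_of xs (repeat N (S l)) -> nth_error xs i = Some x ->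
    closed_of h (Arr N N) -> evalN (App h x) n ->
    evalN (App h (subst (env (zconst 0 l 0 :: xs)) q)) n) -> False.
Proof.
  intros Hqs Hlen Hdom. set (z0 := zconst 0 l 0) in *.
  set (Tz := arrows (repeat N (S l)) N). set (G := Tz :: repeat N (S l)).
  assert (Hz0 : closed_of z0 Tz) by apply (zconst_type 0).
  set (xs := fun ms => map Num ms ++ repeat (bot N) (S l - length ms)).
  assert (Hxs : forall ms, length ms <= S l -> Forall2 closed_of (xs ms) (repeat N (S l))).
  { intros ms Hms. replace (S l) with (length ms + (S l - length ms)) at 1 by lia.
    rewrite repeat_app. apply Forall2_app.
    - clear. induction ms; simpl; constructor; auto. constructor.
    - apply Forall2_repeat, bot_type. }
  assert (Henv : forall ms, length ms <= S l -> Forall2 closed_of (z0 :: xs ms) G)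
    by (constructor; auto).
  set (ev := fun ms M => evalN (subst (env (z0 :: xs ms)) M)).
  assert (mono : forall ms c M n, length ms < S l -> has_type G M N ->
    ev ms M n -> ev (ms ++ [c]) M n).
  { intros ms c M n Hms HM. apply (context_lemma_env G); auto.
    - apply Henv. lia.
    - apply Henv. rewrite length_app; simpl; lia.
    - constructor; [apply app_le_refl|]. unfold xs. rewrite map_app, <- app_assoc.
      apply Forall2_app; [apply Forall2_refl, app_le_refl|].
      rewrite length_app. simpl length.
      replace (S l - length ms) with (S (S l - (length ms + 1))) by lia.
      cbn [repeat map app]. constructor; [apply app_le_bot|].
      apply Forall2_refl, app_le_refl. }
  assert (dom : forall ms c q, nth_error qs (length ms) = Some q -> length ms < S l ->
    ev (ms ++ [c]) q c).
  { intros ms c q Hq Hms. set (h := Lam N (Var 0)).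
    assert (Hid : forall M, steps (App h M) M)
      by (intros M; econstructor; [apply (S_Beta N (Var 0))|constructor]).
    unfold ev. eapply evalN_steps; [apply Hid|].
    apply (Hdom (length ms) q _ (Num c)); auto.
    - apply Hxs. rewrite length_app; simpl; lia.
    - unfold xs. rewrite map_app, <- app_assoc, nth_error_app2, length_map, Nat.sub_diag;
        [reflexivity | rewrite length_map; lia].
    - repeat constructor.
    - apply Hid. }
  (* [D] collects distinct members of [ws] that converge under [ms]; at [m = length qs] it outgrows
     [ws]. *)
  assert (main : forall m, m <= length qs -> exists ms D, length ms = m /\ length D = m /\
    NoDup D /\ forall w, In w D -> In w ws /\ has_type G w N /\ exists v, ev ms w v).
  { induction m as [|m IH]; intros Hm.
    { exists [], []. repeat split; try constructor; easy. }
    destruct IH as (ms & D & Hms & HlD & HD & Hdef); [lia|].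
    destruct (classic (exists c w, In w ws /\ ~ In w D /\ has_type G w N /\
      exists v, ev (ms ++ [c]) w v)) as [(c & w & Hw & HwD & Hwt & Hv)|Hno].
    { exists (ms ++ [c]), (w :: D). rewrite length_app. simpl.
      repeat split; try lia; [now constructor|..];
        (destruct H as [<-|H]; [auto | destruct (Hdef _ H) as (? & ? & v & ?)]; auto).
      exists v. apply mono; auto; lia. }
    (* No numeral makes a new member converge. If a received term has a value with the next argument
       0, its source in [ws] already belongs to [D], so that value was there under [ms] and persists
       with 1. Hence [q] would yield 0 in both cases, against [dom]. *)
    exfalso.
    destruct (nth_error qs m) as [q|] eqn:Eq; [|apply nth_error_None in Eq; lia].
    assert (Hq : ct 0 l (Zs ws) [] q N)
      by (eapply Forall_forall in Hqs; [exact Hqs | eapply nth_error_In; eauto]).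
    rewrite <- Hms in Eq.
    assert (H0 := dom ms 0 q Eq ltac:(lia)). assert (H1 := dom ms 1 q Eq ltac:(lia)).
    cut (ev (ms ++ [1]) q 0).
    { intros H0'. pose proof (evalN_det _ _ _ H0' H1). discriminate. }
    destruct (ct_factor_nil 0 l _ _ _ Hq) as (us & ss & R & Hus & HR & ->).
    assert (Hlu := Forall2_length Hus). simpl rho in *. fold Tz in HR, Hus. fold G in Hus.
    assert (Hfac : forall c, subst (env (z0 :: xs (ms ++ [c]))) (subst (env (Var 0 :: us)) R) =
      subst (env (z0 :: map (subst (env (z0 :: xs (ms ++ [c])))) us)) R).
    { intros c. apply (subst_env_map (Tz :: ss) _ N); auto. simpl. now f_equal. }
    assert (Hc : forall c, length (ms ++ [c]) <= S l)
      by (intros c; rewrite length_app; simpl; lia).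
    assert (Hcl : forall c, Forall2 closed_of
      (z0 :: map (subst (env (z0 :: xs (ms ++ [c])))) us) (Tz :: ss)).
    { intros c. constructor; auto. apply Forall2_map_l. eapply Forall2_impl; [|exact Hus].
      intros u s [Hu _]. eapply has_type_env; [apply Henv, Hc | exact Hu]. }
    unfold ev in H0 |- *. rewrite Hfac in H0 |- *. revert H0.
    apply (context_lemma_env (Tz :: ss)); auto.
    constructor; [apply app_le_refl|]. apply Forall2_map_same. intros u Hu.
    destruct (Forall2_in_l _ _ _ _ Hus Hu) as (s & _ & Hut & Hs & Hw).
    apply sublevel_le_0 in Hs. subst s.
    apply app_le_N; [eapply has_type_env; [apply Henv, Hc | exact Hut]|].
    intros v Huv. destruct (Hw eq_refl) as (w & Hwin & Hwt & Hst).
    simpl rho in Hwt. fold Tz G in Hwt.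
    assert (Hwv : ev (ms ++ [0]) w v).
    { eapply steps_trans; [apply steps_subst, Hst | exact Huv]. }
    assert (HwD : In w D) by (apply NNPP; intros HwD; apply Hno; exists 0, w; eauto).
    destruct (Hdef _ HwD) as (_ & _ & v' & Hv').
    assert (v = v') by (eapply evalN_det; [exact Hwv | apply mono; auto; lia]). subst v'.
    eapply evalN_steps; [apply steps_subst, Hst|]. apply mono; auto; lia. }
  destruct (main _ (le_n _)) as (ms & D & _ & HlD & HD & Hdef).
  enough (length D <= length ws) by lia.
  apply NoDup_incl_length; auto. intros w Hw. apply (Hdef w Hw).
Qed.

Theorem theorem6p3 (k l : nat) (hk : 1 <= k) (hl : 1 <= l) (ss : list ty) :
  (forall s, In s ss -> sublevel_le s k l) ->
  ~ pseudo_retract (rho k (S l)) ss.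
Proof.
  destruct k as [|k]; [lia|]. clear hk hl. revert ss.
  (* The family [ss] stays general, since each step produces a new family one level lower. *)
  induction k as [|k IH]; intros ss Hss (ts & r & Hts & Hr & Hret);
    rewrite rho_S in Hts, Hr, Hret.
  - destruct (retraction_factor 0 l ss ts r Hss Hts Hr Hret)
      as (ws & qs & Hqs & Hlen & [_ Hx] & Hdom).
    apply (ground_contradiction l ws qs); auto.
    specialize (Hx eq_refl). rewrite arity_arrows, repeat_length in Hx. lia.
  - destruct (retraction_factor (S k) l ss ts r Hss Hts Hr Hret)
      as (ws & [|q qs] & Hqs & Hlen & _ & Hdom); [simpl in Hlen; lia|].
    inversion Hqs as [|q' qs' Hq _]; subst.
    destruct (z_arg_pseudo_retract _ _ _ _ Hq) as (ss' & Hss' & Hret').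
    + intros x h n Hx Hh. apply (Hdom 0 q (x :: repeat (bot _) l) x); auto.
      constructor; auto. apply Forall2_repeat, bot_type.
    + exact (IH ss' Hss' Hret').
Qed.
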